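(* Let $f_1,\dots,f_k \in \mathbb{Q}[x_1,\dots,x_n]$ be polynomials that are concave functions on $\mathbb{R}^n$, and let $$C = \bigcap_{i=1}^k \{x \in \mathbb{R}^n \mid f_i(x) > 0\}$$ be their common positivity locus. Then for every real $t>0$ the set $$C_t = \Big\{x \in \mathbb{R}^n \ \Big|\ \prod_{i=1}^k f_i(x) - t > 0\Big\} \cap C$$ is convex.
   Context: A polynomial $f$ is a concave function on a convex set $U \subseteq \mathbb{R}^n$ if $f(\alpha x + (1-\alpha) y) \geq \alpha f(x) + (1-\alpha) f(y)$ for all $x,y \in U$ and all $\alpha \in [0,1]$. The set $C_t$ is called the deformation of $C$. *)

(* Defs.v *)
From mathcomp Require Import all_boot all_order all_algebra.
From mathcomp Require Import classical_sets reals convex.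
From mathcomp Require Import mpoly.

Set Implicit Arguments.
Unset Strict Implicit.
Unset Printing Implicit Defensive.

Import Order.TTheory GRing.Theory Num.Theory.

Local Open Scope classical_set_scope.
Local Open Scope ring_scope.

Definition concave_on (R : realType) (n : nat) (U : set 'rV[R]_n)
    (f : 'rV[R]_n -> R) : Prop :=
  forall x y : 'rV[R]_n, U x -> U y ->
  forall alpha : R, 0 <= alpha -> alpha <= 1 ->
    f (alpha *: x + (1 - alpha) *: y) >= alpha * f x + (1 - alpha) * f y.

Definition polyfun (R : realType) (n : nat) (p : {mpoly rat[n]})
    (x : 'rV[R]_n) : R :=
  (map_mpoly ratr p).@[x 0].

Definition positivity_locus (R : realType) (n k : nat)
    (f : 'I_k -> {mpoly rat[n]}) : set 'rV[R]_n :=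
  \bigcap_(i in [set: 'I_k]) [set x | polyfun (f i) x > 0].

Definition deformation (R : realType) (n k : nat)
    (f : 'I_k -> {mpoly rat[n]}) (t : R) : set 'rV[R]_n :=
  [set x | \prod_(i < k) polyfun (f i) x - t > 0] `&` positivity_locus f.

(* Main.v *)
Require Import Defs.
From mathcomp Require Import all_boot all_order all_algebra.
From mathcomp Require Import classical_sets reals convex interval_inference.
From mathcomp Require Import mpoly.

(** Along a segment with weights [a + b = 1], concavity bounds each [f i] at
the intermediate point from below by [c i = a * u i + b * v i], where [u] and
[v] collect the values at the endpoints.  Since all these numbers are positive,
it is enough that [\prod_i c i] is at least the smaller of [\prod_i u i] and
[\prod_i v i], that is, that the product is quasi-concave on the positive
orthant ([prod_conv_ge]).

Quasi-concavity follows from the AM-GM inequality alone, with no roots or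
logarithms.  Normalise by [c]: the ratios [u i / c i] and [v i / c i] have
weighted mean [1] for every [i], so the sum over [i] of one of the two families
is at most the number of factors.  Then the arithmetic mean of that family is
at most [1], hence so is its product ([prod_le1_of_sum_le]), and the product of
the corresponding endpoint values is at most that of [c]. *)

Import Order.TTheory GRing.Theory Num.Theory.

Local Open Scope classical_set_scope.
Local Open Scope ring_scope.

Lemma min_le_conv (R : realFieldType) (a b s t : R) :
  0 <= a -> 0 <= b -> a + b = 1 -> Num.min s t <= a * s + b * t.
Proof.
move=> a_ge0 b_ge0 ab1; rewrite -[leLHS]mul1r -ab1 mulrDl.
by rewrite lerD // ler_wpM2l // ge_min lexx ?orbT.
Qed.

Lemma conv_gt0 (R : realFieldType) (a b s t : R) :
  0 <= a -> 0 <= b -> a + b = 1 -> 0 < s -> 0 < t -> 0 < a * s + b * t.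
Proof.
move=> a_ge0 b_ge0 ab1 s_gt0 t_gt0.
apply: lt_le_trans (min_le_conv _ _ _ s t a_ge0 b_ge0 ab1).
by rewrite lt_min s_gt0.
Qed.

(** This is AM-GM: the product is at most the [#|I|]-th power of the mean. *)
Lemma prod_le1_of_sum_le (R : realFieldType) (I : finType) (w : I -> R) :
  (forall i, 0 <= w i) -> \sum_i w i <= #|I|%:R -> \prod_i w i <= 1.
Proof.
move=> w_ge0 sum_w; have w_in : {in I, forall i, 0 <= w i} by move=> i _.
have [le_pm _] := leif_AGM w_in; apply: le_trans le_pm _.
apply: exprn_ile1; first by rewrite divr_ge0 ?ler0n ?sumr_ge0.
(* For empty [I] the mean is [0 / 0], which is [0]. *)
have [->|I_gt0] := posnP #|I|; first by rewrite invr0 mulr0 ler01.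
by rewrite ler_pdivrMr ?ltr0n ?mul1r.
Qed.

Lemma prod_le_of_sum_ratio_le (R : realFieldType) (I : finType)
    (u c : I -> R) :
    (forall i, 0 < u i) -> (forall i, 0 < c i) ->
    \sum_i u i / c i <= #|I|%:R ->
  \prod_i u i <= \prod_i c i.
Proof.
move=> u_gt0 c_gt0 sum_uc.
have prod_c_gt0 : 0 < \prod_i c i by apply: prodr_gt0 => i _.
rewrite -[leRHS]mul1r -ler_pdivrMr // -prodf_div.
by apply: prod_le1_of_sum_le => // i; rewrite divr_ge0 ?ltW.
Qed.

(** Write [c i] for the factors on the right.  The sums of the ratios [u i / c i]
and [v i / c i] have weighted mean [#|I|], so one of them is at most [#|I|],
and AM-GM bounds the product of that family of ratios by [1]. *)
Lemma prod_conv_ge (R : realFieldType) (I : finType) (a b : R) (u v : I -> R) :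
    0 <= a -> 0 <= b -> a + b = 1 ->
    (forall i, 0 < u i) -> (forall i, 0 < v i) ->
  Num.min (\prod_i u i) (\prod_i v i) <= \prod_i (a * u i + b * v i).
Proof.
move=> a_ge0 b_ge0 ab1 u_gt0 v_gt0.
pose c i := a * u i + b * v i.
have c_gt0 i : 0 < c i by apply: conv_gt0.
have mean_ratio :
    a * (\sum_i u i / c i) + b * (\sum_i v i / c i) = #|I|%:R.
  rewrite !mulr_sumr -big_split /= (eq_bigr (fun=> 1)) ?sumr_const // => i _.
  by rewrite !mulrA -mulrDl divff //; apply/lt0r_neq0/c_gt0.
have := min_le_conv _ _ _ (\sum_i u i / c i) (\sum_i v i / c i)
  a_ge0 b_ge0 ab1.
rewrite mean_ratio !ge_min.
by case/orP=> /prod_le_of_sum_ratio_le le_prod; rewrite le_prod ?orbT.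
Qed.

Theorem proposition3p4 (R : realType) (n k : nat)
    (f : 'I_k -> {mpoly rat[n]})
    (f_concave : forall i : 'I_k,
       concave_on [set: 'rV[R]_n] (polyfun (R := R) (f i)))
    (t : R) (t_gt0 : 0 < t) :
  @convex_set R 'rV[R]_n (deformation f t).
Proof.
move=> x y p /set_mem [/= + x_pos] /set_mem [/= + y_pos].
rewrite !subr_gt0 => prod_x prod_y; apply/mem_set.
have fx_gt0 i : 0 < polyfun (f i) x by exact: x_pos.
have fy_gt0 i : 0 < polyfun (f i) y by exact: y_pos.
pose a : R := p%:num.
have a_ge0 : 0 <= a by rewrite /a.
have a_le1 : a <= 1 by rewrite /a.
have b_ge0 : 0 <= 1 - a by rewrite subr_ge0.
have ab1 : a + (1 - a) = 1 by rewrite addrC subrK.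
have f_ge i : a * polyfun (f i) x + (1 - a) * polyfun (f i) y
              <= polyfun (f i) (conv p x y).
  exact: f_concave.
have mid_gt0 i : 0 < a * polyfun (f i) x + (1 - a) * polyfun (f i) y.
  exact: conv_gt0.
split=> /= [|i _ /=]; last exact: lt_le_trans (mid_gt0 i) (f_ge i).
have min_gt_t : t < Num.min (\prod_(i < k) polyfun (f i) x)
                            (\prod_(i < k) polyfun (f i) y).
  by rewrite lt_min prod_x.
rewrite subr_gt0; apply: lt_le_trans min_gt_t _.
apply: le_trans (prod_conv_ge _ _ _ _ _ _ a_ge0 b_ge0 ab1 fx_gt0 fy_gt0) _.
by apply: ler_prod => i _; rewrite f_ge ltW.
Qed.
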